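(* Let $\Phi(t)$ be the fundamental matrix, with $\Phi(0)=I$, of the linear cyclic negative feedback system $$\dot x_1=a_{11}(t)x_1+a_{1n}(t)x_n,\qquad \dot x_i=a_{i,i-1}(t)x_{i-1}+a_{ii}(t)x_i,\quad 2\le i\le n,$$ whose coefficients are continuous on $\mathbb{R}$ and satisfy $a_{1n}(t)<0$ and $a_{i,i-1}(t)>0$ for $2\le i\le n$ and all $t\in\mathbb{R}$. Let $h$ be an integer with $0\le h\le\frac{\tilde n+1}{2}$. Then for any $t>0$, $$\Phi(t)(\bar K_h\setminus\{0\})\subset \mathrm{Int}\,\bar K_h.$$
   Context: Here $n\ge2$; $\tilde n=n$ if $n$ is odd and $\tilde n=n-1$ if $n$ is even. Put $\delta_1=-1$, $\delta_i=1$ for $2\le i\le n$, and $x_0:=x_n$. On $\Lambda=\{x\in\mathbb{R}^n: x_i\ne0,\ i=1,\dots,n\}$ define $N(x)=\mathrm{card}\{i\in\{1,\dots,n\}:\delta_i x_ix_{i-1}<0\}$; it takes values in $\{1,3,\dots,\tilde n\}$. For $x\in\mathbb{R}^n$, let $N_M(x)$ be the maximum of $N(x')$ over $x'\in\mathcal{U}\cap\Lambda$, where $\mathcal{U}$ is a sufficiently small neighborhood of $x$. For an integer $0\le h\le\frac{\tilde n+1}{2}$, let $K_h=\{0\}\cup\{x\in\mathbb{R}^n:N_M(x)\le 2h-1\}$ (so $K_0=\{0\}$). $\bar K_h$ is the closure of $K_h$ and $\mathrm{Int}\,\bar K_h$ the interior of $\bar K_h$. *)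

(* Defs.v *)
From HB Require Import structures.
From mathcomp Require Import all_boot all_order all_algebra.
From mathcomp Require Import all_classical all_reals all_analysis.

Set Implicit Arguments.
Unset Strict Implicit.
Unset Printing Implicit Defensive.

Import Order.TTheory GRing.Theory Num.Theory.
Import numFieldNormedType.Exports.

Local Open Scope classical_set_scope.
Local Open Scope ring_scope.

(* Coordinates are numbered from 0: x_i of the usual notation is [x (i-1) 0].  *)
(* The index i - 1, with the convention x_0 := x_n, is the cyclic predecessor  *)
(* [ord_pred i], and the distinguished first index is the one with value 0.    *)

Definition ntilde (n : nat) : nat := if odd n then n else n.-1.

Definition delta (R : realType) (n : nat) (i : 'I_n) : R :=
  if val i == 0%N then -1 else 1.

Definition Lambda (R : realType) (n : nat) : set 'cV[R]_n :=
  [set x | forall i, x i 0 != 0].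

(* The formula makes sense off [Lambda], but only its values on [Lambda] are   *)
(* used below.                                                                 *)
Definition Nsign (R : realType) (n : nat) (x : 'cV[R]_n) : nat :=
  #|[set i : 'I_n | delta R i * x i 0 * x (ord_pred i) 0 < 0]%SET|.

Definition is_max_Nsign (R : realType) (n : nat) (U : set 'cV[R]_n) (m : nat) :
    Prop :=
  (exists2 y, (U `&` @Lambda R n) y & Nsign y = m) /\
  (forall y, (U `&` @Lambda R n) y -> (Nsign y <= m)%N).

(* Sufficiently small neighborhoods of x are expressed by the library filter   *)
(* [powerset_filter_from (nbhs x)]; the default 0 of [xget] is never used, by  *)
(* [NM_spec] below.                                                            *)
Definition NM (R : realType) (n : nat) (x : 'cV[R]_n) : nat :=
  xget 0%N [set m | \forall U \near powerset_filter_from (nbhs x),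
                      is_max_Nsign U m].

(* The inequality is taken in [int], so that its right-hand side is -1 (and    *)
(* K_0 = {0}) for h = 0.                                                       *)
Definition K (R : realType) (n h : nat) : set 'cV[R]_n :=
  [set 0] `|` [set x | (Posz (NM x) <= 2 * Posz h - 1)%R].

Definition cyclic_negative_feedback (R : realType) (n : nat)
    (a : R -> 'M[R]_n) : Prop :=
  [/\ forall i j : 'I_n, continuous (fun t : R => a t i j),
      forall (t : R) (i j : 'I_n), j != i -> j != ord_pred i -> a t i j = 0,
      forall (t : R) (i : 'I_n), val i = 0%N -> a t i (ord_pred i) < 0
    & forall (t : R) (i : 'I_n), val i <> 0%N -> 0 < a t i (ord_pred i)].

Definition fundamental_matrix (R : realType) (n : nat)
    (a Phi : R -> 'M[R]_n) : Prop :=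
  Phi 0 = 1%:M /\ forall t : R, is_derive t (1 : R) Phi (a t *m Phi t).

Lemma Lambda_dense (R : realType) (n : nat) (x : 'cV[R]_n) (U : set 'cV[R]_n) :
  nbhs x U -> U `&` @Lambda R n !=set0.
Proof.
move=> /nbhs_ballP[e /= e0 eU].
exists (\col_i (if x i 0 == 0 then e / 2 else x i 0)); split.
  apply: eU; split=> // i j; rewrite mxE (ord1 j).
  case: ifPn => [/eqP ->|_]; last exact: ballxx.
  rewrite /ball/= sub0r normrN ger0_norm ?divr_ge0 ?ltW//.
  by rewrite ltr_pdivrMr// ltr_pMr// ltr1n.
move=> i; rewrite mxE; case: ifPn => // _.
by rewrite mulf_neq0 ?gt_eqF ?invr_gt0.
Qed.

Lemma NM_spec (R : realType) (n : nat) (x : 'cV[R]_n) :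
  \forall U \near powerset_filter_from (nbhs x), is_max_Nsign U (NM x).
Proof.
suff /= [m Pm] : exists m : nat, \forall U \near powerset_filter_from (nbhs x),
    is_max_Nsign U m.
  by rewrite /NM; case: xgetP => [_ -> //|/(_ m)].
pose b m := `[< exists2 U, nbhs x U &
  forall y, (U `&` @Lambda R n) y -> (Nsign y <= m)%N >].
have [m /asboolP[V xV Vm] mmin] : {m | b m & forall k, b k -> (m <= k)%N}.
  suff bn : exists m, b m by case: (ex_minnP bn) => m; exists m.
  exists n; apply/asboolP; exists setT; first exact: filterT.
  by move=> y _; rewrite -[leqRHS]card_ord max_card.
exists m; near=> U.
have xU : nbhs x U by near: U; exact: near_small_set.
have UV : U `<=` V by near: U; exact: small_set_sub.
have Um y : (U `&` @Lambda R n) y -> (Nsign y <= m)%N.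
  by move=> [/UV Vy Ly]; exact: Vm.
split=> //; apply: contrapT => Nm.
have ltm y : (U `&` @Lambda R n) y -> (Nsign y < m)%N.
  move=> Uy; rewrite ltn_neqAle Um// andbT.
  by apply/eqP => ym; apply: Nm; exists y.
have [y0 /ltm y0m] := Lambda_dense xU.
have : b m.-1.
  apply/asboolP; exists U => // y /ltm.
  by case: (m) => // k; rewrite ltnS.
by move/mmin; case: (m) y0m => // k _; rewrite ltnn.
Unshelve. all: by end_near. Qed.

(* Main.v *)
(* Near a time t at which a nonzero solution x has vanishing coordinates, each  *)
(* such coordinate is driven by its predecessor.  Just after t it therefore     *)
(* agrees in sign with delta_i x_(i-1), which gives the fewest sign changes     *)
(* among all small perturbations of x(t); just before t it disagrees, which     *)
(* gives the most.  Hence N_M(x(t)) is at most the value of N just before t and *)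
(* the value of N just after t is at most the minimum of N near x(t), so along  *)
(* the flow N_M(x(t)), for t > 0, never exceeds the minimum of N near x(0).     *)
(* Points of the closure of K_h other than 0 are those where this minimum is at *)
(* most 2h - 1, and N_M <= 2h - 1 is an open condition.                         *)

Require Import Defs.
From mathcomp Require Import all_boot all_order all_algebra.
From mathcomp Require Import all_classical all_reals all_analysis.
From mathcomp Require Import ring lra zify.

Import Order.TTheory GRing.Theory Num.Theory.
Import numFieldNormedType.Exports.

Local Open Scope classical_set_scope.
Local Open Scope ring_scope.

(** Two conditions on a state are played against each other: [Nsign < m] at points of [Lambda]
    arbitrarily near it, and [Nsign < m] at all points of [Lambda] close to it, an open condition
    equivalent to [NM < m] ([NM_ltP]). Along a nonzero solution the weak one yields the strong one
    right afterwards ([Nsign_right]), and the strong one survives limits in time from the left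
    ([Nsign_left]); hence [Nsign_flow_lt], applied with [m = 2h]. The sign patterns behind this come
    from [cyclic_ode_signs]; [Nsign_min] and [Nsign_max] turn them into counts. *)

Lemma ord_cyclic_ind (n : nat) (P : 'I_n -> Prop) (j : 'I_n) :
  P j -> (forall i, P (ord_pred i) -> P i) -> forall i, P i.
Proof.
move=> Pj PS i.
have Pk k : P (iter k (@ordS n) j).
  by elim: k => //= k IH; apply: PS; rewrite ordSK.
have itE k : val (iter k (@ordS n) j) = ((j + k) %% n)%N.
  elim: k => [|k IH]; first by rewrite addn0 modn_small.
  by rewrite iterS /= IH -addn1 modnDml addn1 addnS.
(* From [j], [n - j] steps forward reach 0 modulo [n], and [i] more reach [i]. *)
suff -> : i = iter (n - j + i) (@ordS n) j by [].
apply: val_inj; rewrite itE addnA subnKC; last exact: ltnW.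
by rewrite modnDl modn_small.
Qed.

(** The [d] terms cancel on summation because [ord_pred] permutes the indices. *)
Lemma leq_sum_shift (n : nat) (f g d : 'I_n -> nat) :
  (forall i, f i + d i <= g i + d (ord_pred i))%N ->
  (\sum_i f i <= \sum_i g i)%N.
Proof.
move=> H; have : (\sum_i (f i + d i) <= \sum_i (g i + d (ord_pred i)))%N.
  exact: leq_sum.
rewrite !big_split /= [X in (_ <= _ + X)%N](_ : _ = \sum_i d i)%N ?leq_add2r//.
by rewrite [RHS](reindex (@ord_pred n)) //=; exact/onW_bij/ord_pred_bij.
Qed.

(** * Sign changes under small perturbations *)

Section SignChanges.
Context {R : realType} {n : nat}.
Implicit Types x y z : 'cV[R]_n.

Lemma NsignE x : Nsign x =
  (\sum_i (delta R i * x i ord0 * x (ord_pred i) ord0 < 0)%R)%N.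
Proof. by rewrite /Nsign -sum1dep_card big_mkcond. Qed.

Lemma delta_neq0 (i : 'I_n) : delta R i != 0.
Proof. by rewrite /delta; case: ifP; rewrite ?oppr_eq0 oner_eq0. Qed.

Lemma mulr_lt0_addb (u v : R) :
  u != 0 -> v != 0 -> (u * v < 0) = (u < 0) (+) (v < 0).
Proof. by move=> u0 v0; rewrite mulr_lt0 u0 v0. Qed.

Lemma mulr_gt0_addb (u v : R) :
  u != 0 -> v != 0 -> (0 < u * v) = ~~ ((u < 0) (+) (v < 0)).
Proof.
by move=> u0 v0; rewrite -mulr_lt0_addb// -leNgt le_eqVlt eq_sym mulf_eq0
  (negPf u0) (negPf v0).
Qed.

(* With d_i = 1 when y_i and z_i have opposite signs and d_i = 0 otherwise, the *)
(* i-th terms of the two counts differ by at most d_(i-1) - d_i, and these      *)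
(* differences cancel around the cycle.                                         *)
Lemma Nsign_min x y z : Lambda y -> Lambda z ->
  (forall i, x i 0 != 0 -> 0 < x i 0 * y i 0) ->
  (forall i, x i 0 != 0 -> 0 < x i 0 * z i 0) ->
  (forall i, x i 0 = 0 -> 0 < delta R i * y i 0 * y (ord_pred i) 0) ->
  (Nsign y <= Nsign z)%N.
Proof.
move=> Ly Lz xy xz x0y; rewrite !NsignE.
apply: (@leq_sum_shift _ _ _ (fun i => (y i 0 * z i 0 < 0)%R : nat)) => i /=.
have [yi zi yp zp di] : [/\ y i 0 != 0, z i 0 != 0, y (ord_pred i) 0 != 0,
    z (ord_pred i) 0 != 0 & delta R i != 0] by split => //; exact: delta_neq0.
move: (xy i) (xz i) (x0y i).
rewrite (@mulr_gt0_addb (delta R i * _)) ?mulf_neq0// !mulr_lt0_addb ?mulf_neq0//.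
have [-> _ _ /(_ erefl)|x0 /(_ isT) + /(_ isT) + _] := eqVneq (x i 0) 0.
  by do !case: (_ < 0).
by rewrite !mulr_gt0_addb//; do !case: (_ < 0).
Qed.

(** The cancellation of [Nsign_min] again: where [x_i = 0], the term of [y] is already 1, its
    largest value. *)
Lemma Nsign_max x y z : Lambda y -> Lambda z ->
  (forall i, x i 0 != 0 -> 0 < x i 0 * y i 0) ->
  (forall i, x i 0 != 0 -> 0 < x i 0 * z i 0) ->
  (forall i, x i 0 = 0 -> delta R i * y i 0 * y (ord_pred i) 0 < 0) ->
  (Nsign z <= Nsign y)%N.
Proof.
move=> Ly Lz xy xz x0y; rewrite !NsignE.
apply: (@leq_sum_shift _ _ _ (fun i => (y i 0 * z i 0 < 0)%R : nat)) => i /=.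
have [yi zi yp zp di] : [/\ y i 0 != 0, z i 0 != 0, y (ord_pred i) 0 != 0,
    z (ord_pred i) 0 != 0 & delta R i != 0] by split => //; exact: delta_neq0.
move: (xy i) (xz i) (x0y i); rewrite !mulr_lt0_addb ?mulf_neq0//.
have [-> _ _ /(_ erefl)|x0 /(_ isT) + /(_ isT) + _] := eqVneq (x i 0) 0.
  by do !case: (_ < 0).
by rewrite !mulr_gt0_addb//; do !case: (_ < 0).
Qed.

Lemma near_same_sign x :
  \forall z \near x, forall i, x i 0 != 0 -> 0 < x i 0 * (z : 'cV[R]_n) i 0.
Proof.
apply: (@filter_forall _ _ _ (nbhs x)) => i.
have [->|xi] := eqVneq (x i 0) 0; first exact: nearW.
have cx : {for x, continuous (fun z : 'cV[R]_n => z i 0)}.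
  exact: coord_continuous.
have x2 : 0 < x i 0 * x i 0 by rewrite -expr2 exprn_even_gt0.
by apply: filterS (cvgr_gt _ (cvgMl_tmp cx) _ x2).
Qed.

Lemma NM_ltP x m : (0 < m)%N ->
  ((NM x < m)%N <-> \forall z \near x, Lambda z -> (Nsign z < m)%N).
Proof.
have small := near_small_set (nbhs_pfilter x).
case: m => // m _; rewrite ltnS; split=> [Nm|xm].
  have [U [xU HU]] := filter_ex (filterI small (NM_spec x)).
  by apply: filterS xU => z Uz Lz; rewrite ltnS (leq_trans _ Nm)//; apply: HU.2.
have [U [US [[y [Uy Ly] <-] _]]] :=
  filter_ex (filterI (small_set_sub xm) (NM_spec x)).
exact: US.
Qed.

End SignChanges.

(** * Scalar and linear differential equations *)

Section ODE.
Context {R : realType}.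
Implicit Types (s t : R).

Lemma at_rightP t (P : R -> Prop) : (\forall s \near t^'+, P s) <->
  exists2 e, 0 < e & forall s, t < s < t + e -> P s.
Proof.
rewrite near_withinE; split=> [/nbhs_ballP[e /= e0 H]|[e e0 H]].
  exists e => // s /andP[ts se]; apply: H => //.
  by rewrite /ball /= ltr0_norm ?subr_lt0// opprB ltrBlDl.
near=> s => ts; apply: H; rewrite ts /=.
by near: s; apply: lt_nbhsl; rewrite ltrDl.
Unshelve. all: by end_near. Qed.

Lemma is_derive_expRM (c t df : R) (f : R -> R) :
  is_derive t 1 f df ->
  is_derive t 1 (fun s => expR (c * s) * f s) (expR (c * t) * (c * f t + df)).
Proof.
move=> fdf.
have cd : is_derive t 1 ( *%R c) c.
  have -> : *%R c = c \*: id :> (R -> R) by [].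
  by apply: is_derive_eq; rewrite [LHS]mulr1.
have ed := is_derive1_comp (is_derive_expR (c * t)) cd.
apply: (is_derive_eq (is_deriveM _ _)).
rewrite /=; rewrite ![_ *: _]mulrC; ring.
Qed.

Lemma is_derive_continuous (f : R -> R) (df : R -> R) :
  (forall t, is_derive t 1 f (df t)) -> continuous f.
Proof.
by move=> fdf t; apply/differentiable_continuous/derivable1_diffP; exact: ex_derive.
Qed.

Lemma is_derive_gt0_left (f : R -> R) (t df : R) :
  is_derive t 1 f df -> 0 < df -> \forall s \near t^'-, f s < f t.
Proof.
move=> [fd <-] df0.
have : \forall h \near 0^', 0 < h^-1 *: ((f \o shift t) h%:A - f t).
  exact: (cvgr_gt _ fd).
rewrite near_withinE => /nbhs_ballP[e /= e0 H]; apply/nbhs_left0P/at_rightP.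
exists e => // s; rewrite add0r => /andP[s0 se].
have := H (- s); rewrite /ball /= sub0r opprK gtr0_norm// oppr_eq0 gt_eqF//.
move=> /(_ se isT); rewrite [_%:A]mulr1 [- s + t]addrC [_ *: _]mulrC.
by rewrite nmulr_lgt0 ?invr_lt0 ?oppr_lt0// subr_lt0.
Qed.

(* Multiplying y by exp(-cs) with c > al(t) makes the coefficient of y negative *)
(* near t, so the result increases wherever it is nonpositive.                  *)
Lemma scalar_ode_gt0 (y al b : R -> R) (t : R) :
  (forall s, is_derive s 1 y (al s * y s + b s)) ->
  {for t, continuous al} -> y t = 0 ->
  (\forall s \near t^'+, 0 < b s) -> \forall s \near t^'+, 0 < y s.
Proof.
move=> dy cal yt0 b0; pose c := al t + 1.
have : \forall s \near t^'+, 0 < b s /\ al s < c.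
  apply: filterI => //; have calr := @cvg_at_right_filter _ _ al t (al t) cal.
  by apply: (cvgr_lt _ calr); rewrite ltrDl.
move/at_rightP => [e e0 H]; apply/at_rightP; exists e => // s /andP[ts se].
rewrite ltNge; apply/negP => ys0.
pose z s := expR (- c * s) * y s.
have dz s' : is_derive s' 1 z
    (expR (- c * s') * (- c * y s' + (al s' * y s' + b s'))).
  exact: is_derive_expRM.
have zc : continuous z by exact: is_derive_continuous dz.
have pos p : t < p < t + e -> y p <= 0 ->
    0 < expR (- c * p) * (- c * y p + (al p * y p + b p)).
  move=> /H[bp ap] yp; rewrite mulr_gt0 ?expR_gt0//.
  rewrite addrA -mulrDl ltr_wpDl// mulr_le0//; lra.
have [p ptz pmin] := EVT_min (ltW ts) (continuous_subspaceT zc).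
(* A minimiser [q] other than [t] is absurd: [z q <= z s <= 0] makes the derivative of [z] at [q]
   positive, so [z] is smaller just before [q]. If the minimum is at [t], where [z] vanishes, then
   [s] is a minimiser too. *)
suff [q tqs qmin] : exists2 q, t < q <= s & forall r, t <= r <= s -> z q <= z r.
  case/andP: tqs => tq qs.
  have yq : y q <= 0.
    have : z q <= z s by rewrite qmin// lexx ltW.
    by move/le_trans => /(_ 0); rewrite /z !pmulr_rle0 ?expR_gt0//; exact.
  have qe : t < q < t + e by rewrite tq (le_lt_trans qs).
  have : \forall r \near q^'-, t < r /\ z r < z q.
    apply: filterI; first exact: nbhs_left_gt.
    by apply: is_derive_gt0_left (dz q) _; exact: pos.
  have qr : \forall r \near q^'-, r < q by exact: nbhs_left_lt.
  move=> /(filterI qr) /filter_ex[r [rq [tr]]]; apply/negP.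
  by rewrite -leNgt qmin// ltW//= (le_trans (ltW rq)).
move: ptz; rewrite in_itv/= => /andP[]; rewrite le_eqVlt => /predU1P[pt|tp] ps.
  exists s; first by rewrite ts lexx.
  move=> r tr; apply: le_trans (pmin r _); last by rewrite in_itv.
  by rewrite -pt /z yt0 mulr0 pmulr_rle0// expR_gt0.
by exists p; [rewrite tp|move=> r tr; apply: pmin; rewrite in_itv].
Qed.

(* For C large on [0, t], exp(Cs) |x(s)|^2 is nondecreasing there.              *)
Lemma linear_ode_neq0 (n : nat) (a : R -> 'M[R]_n) (x : R -> 'cV[R]_n) :
  (forall i j, continuous (fun t => a t i j)) ->
  (forall t i, is_derive t 1 (fun s => x s i 0) ((a t *m x t) i 0)) ->
  forall t, 0 <= t -> x 0 != 0 -> x t != 0.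
Proof.
move=> ca dx t t0 x0; pose V s := \sum_i x s i 0 ^+ 2.
have VP s : (0 < V s) = (x s != 0).
  rewrite lt_def sumr_ge0 ?andbT; last by move=> i _; exact: sqr_ge0.
  congr (~~ _); apply/eqP/eqP => [Vs|xs0]; last first.
    by rewrite /V xs0 big1// => i _; rewrite mxE expr0n.
  apply/matrixP => i j; rewrite (ord1 j) mxE; apply/eqP; rewrite -sqrf_eq0.
  by apply/eqP/(psumr_eq0P _ Vs) => // k _; exact: sqr_ge0.
have dV s : is_derive s 1 V (\sum_i 2 * (x s i 0 * (a s *m x s) i 0)).
  have -> : V = \sum_i ((fun s => x s i 0) ^+ 2).
    by apply/funext => r; rewrite fct_sumE; apply: eq_bigr => i _; rewrite !expr2.
  apply: is_derive_eq.
  by apply: eq_bigr => i _ /=; rewrite [_ *: _]mulrC expr1; ring.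
pose A s : R := \sum_i \sum_j `|a s i j|.
have Ac : continuous A.
  apply: continuous_big => [|i _]; first exact: add_continuous.
  apply: continuous_big => [|j _ s]; first exact: add_continuous.
  by apply: cvg_norm; exact: ca.
have [c _ cmax] := EVT_max t0 (continuous_subspaceT Ac).
(* As [|x_i x_j| <= V], the derivative of [V] is at least [-2 A V], and [A c] is the maximum of [A]
   on [[0, t]]. *)
pose C := 2 * A c.
pose W s := expR (C * s) * V s.
have dW s : is_derive s 1 W
    (expR (C * s) * (C * V s + \sum_i 2 * (x s i 0 * (a s *m x s) i 0))).
  exact: is_derive_expRM.
have xV s i : `|x s i 0| ^+ 2 <= V s.
  rewrite real_normK ?num_real// /V (bigD1 i)//= lerDl sumr_ge0// => j _.
  exact: sqr_ge0.
have W'0 s : s \in `]0, t[%R -> 0 <= derive1 W s.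
  move=> st; rewrite derive1E derive_val mulr_ge0 ?expR_ge0// -lerBlDr sub0r.
  rewrite -mulr_sumr -mulrN /C -mulrA ler_pM2l//.
  apply: (@le_trans _ _ (A s * V s)); last first.
    rewrite ler_wpM2r//; last by apply: cmax; exact: subset_itv_oo_cc st.
    by apply: sumr_ge0 => i _; exact: sqr_ge0.
  rewrite -sumrN /A mulr_suml ler_sum// => i _.
  rewrite mxE -mulrN -sumrN mulr_sumr mulr_suml ler_sum// => j _.
  rewrite (le_trans (ler_norm _))// !(normrM, normrN).
  have := xV s i; have := xV s j; have := normr_ge0 (a s i j).
  have := normr_ge0 (x s i 0); have := normr_ge0 (x s j 0).
  set u := `|x s i 0|; set v := `|x s j 0|; set w := `|_| => v0 u0 w0 vV uV.
  rewrite mulrCA ler_wpM2l//. nra.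
have Wc := is_derive_continuous _ _ dW.
have := @ger0_derive1_ndecr _ W 0 t _ W'0 (continuous_subspaceT Wc) 0 t.
rewrite !lexx => /(_ _ isT t0 isT) WW; rewrite -VP.
rewrite -(@pmulr_rgt0 _ (expR (C * t))) ?expR_gt0//; apply: lt_le_trans (WW _) => //.
by rewrite /W mulr_gt0 ?expR_gt0 ?VP.
Qed.

End ODE.

(** * The cyclic system and its flow *)

Section Cyclic.
Context {R : realType} {n : nat}.
Implicit Types (s t : R) (x : R -> 'cV[R]_n) (a : R -> 'M[R]_n).

(* The sign of the coupling is arbitrary so that the lemma also applies to the *)
(* time-reversed system.                                                        *)
Lemma cyclic_ode_signs x (al be : 'I_n -> R -> R) (e : 'I_n -> R) t :
  (forall s i, is_derive s 1 (fun r => x r i 0)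
     (al i s * x s i 0 + be i s * x s (ord_pred i) 0)) ->
  (forall i, {for t, continuous (al i)}) ->
  (forall s i, 0 < e i * be i s) -> x t != 0 ->
  \forall s \near t^'+, [/\ Lambda (x s),
    forall i, x t i 0 != 0 -> 0 < x t i 0 * x s i 0 &
    forall i, x t i 0 = 0 -> 0 < e i * x s i 0 * x s (ord_pred i) 0].
Proof.
move=> dx cal eb xt0.
have xc i : x s i 0 @[s --> t^'+] --> x t i 0.
  apply: cvg_at_right_filter.
  exact: (is_derive_continuous _ _ (fun s => dx s i)).
have ne0 i : x t i 0 != 0 -> \forall s \near t^'+, 0 < x t i 0 * x s i 0.
  move=> xi; have x2 : 0 < x t i 0 * x t i 0 by rewrite -expr2 exprn_even_gt0.
  exact: (cvgr_gt _ (cvgMl_tmp (xc i)) _ x2).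
(* [u * e i * x_i] starts at 0 and is forced by [(e i * be i) * (u * x_(i-1))], which is positive
   just after [t]. *)
have eq0 i u : x t i 0 = 0 ->
    (\forall s \near t^'+, 0 < u * x s (ord_pred i) 0) ->
    \forall s \near t^'+, 0 < u * e i * x s i 0.
  move=> xi ux; pose b s := u * e i * (be i s * x s (ord_pred i) 0).
  apply: (@scalar_ode_gt0 _ _ (al i) b) => //; last 2 first.
  - by rewrite xi mulr0.
  - apply: filterS ux => s us.
    by rewrite /b mulrACA [e i * _]mulrC mulrACA mulr_gt0 // mulrC.
  move=> s; have -> : (fun r => u * e i * x r i 0) =
    (u * e i) \*: (fun r => x r i 0) :> (R -> R) by [].
  by apply: is_derive_eq; rewrite /b /GRing.scale/=; ring.
(* Definite signs spread around the cycle from one coordinate that is nonzero at [t]. *)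
have signed : forall i, exists u, \forall s \near t^'+, 0 < u * x s i 0.
  have [j xj] := cV0Pn _ xt0.
  apply: (ord_cyclic_ind _ _ j); first by exists (x t j 0); exact: ne0.
  move=> i [u ux]; have [xi|xi] := eqVneq (x t i 0) 0.
    by exists (u * e i); exact: eq0.
  by exists (x t i 0); exact: ne0.
have all_i : \forall s \near t^'+, forall i, [/\ x s i 0 != 0,
    x t i 0 != 0 -> 0 < x t i 0 * x s i 0 &
    x t i 0 = 0 -> 0 < e i * x s i 0 * x s (ord_pred i) 0].
  apply: filter_forall => i; have [xi|xi] := eqVneq (x t i 0) 0.
    have [u ux] := signed (ord_pred i).
    apply: filterS2 ux (eq0 i u xi ux) => s us es; split=> // [|_].
      by apply/eqP => xs0; move: es; rewrite xs0 mulr0 ltxx.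
    have := mulr_gt0 us es.
    have -> : u * x s (ord_pred i) 0 * (u * e i * x s i 0) =
      u ^+ 2 * (e i * x s i 0 * x s (ord_pred i) 0) by ring.
    rewrite pmulr_rgt0// exprn_even_gt0//=.
    by apply/eqP => u0; move: us; rewrite u0 mul0r ltxx.
  apply: filterS (ne0 i xi) => s xs; split=> // [|xi0]; last by rewrite xi0 eqxx in xi.
  by apply/eqP => xs0; move: xs; rewrite xs0 mulr0 ltxx.
by apply: filterS all_i => s H; split=> i; case: (H i).
Qed.

Definition solves a x :=
  forall t i, is_derive t 1 (fun s => x s i 0) ((a t *m x t) i 0).

Lemma ord_pred_neq (i : 'I_n) : (2 <= n)%N -> ord_pred i != i.
Proof.
move=> n2; rewrite -val_eqE /=; case: (val i) (ltn_ord i) => [|k] kn /=.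
  by rewrite add0n modn_small; lia.
by rewrite modnDr modn_small; lia.
Qed.

Lemma cyclic_mulE a x t i : (2 <= n)%N -> cyclic_negative_feedback a ->
  (a t *m x t) i 0 =
    a t i i * x t i 0 + a t i (ord_pred i) * x t (ord_pred i) 0.
Proof.
move=> n2 [_ a0 _ _]; rewrite mxE (bigD1 i)//= (bigD1 (ord_pred i)) ?ord_pred_neq//=.
by rewrite big1 ?addr0// => j /andP[ji jp]; rewrite a0// mul0r.
Qed.

Lemma delta_coupling_gt0 a t i : cyclic_negative_feedback a ->
  0 < delta R i * a t i (ord_pred i).
Proof.
move=> [_ _ neg pos]; rewrite /delta; case: eqP => i0.
  by rewrite mulN1r oppr_gt0; exact: neg.
by rewrite mul1r; exact: pos.
Qed.

Lemma Nsign_right a x t : (2 <= n)%N -> cyclic_negative_feedback a ->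
  solves a x -> x t != 0 ->
  \forall s \near t^'+, Lambda (x s) /\
    \forall z \near x t, Lambda z -> (Nsign (x s) <= Nsign z)%N.
Proof.
move=> n2 ha dx xt0.
have : \forall s \near t^'+, [/\ Lambda (x s),
    forall i, x t i 0 != 0 -> 0 < x t i 0 * x s i 0 &
    forall i, x t i 0 = 0 -> 0 < delta R i * x s i 0 * x s (ord_pred i) 0].
  apply: (cyclic_ode_signs _ (fun i s => a s i i)
    (fun i s => a s i (ord_pred i))) => // [s i|i|s i].
  - by rewrite -cyclic_mulE.
  - by case: ha => ac _ _ _; exact: ac.
  - exact: delta_coupling_gt0.
apply: filterS => s [Ls xs x0s]; split=> //.
apply: filterS (near_same_sign (x t)) => z xz Lz.
exact: (Nsign_min _ _ _ Ls Lz xs xz).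
Qed.

(** Reversing time negates the coupling, so [cyclic_ode_signs] applies with [e = - delta] and gives
    the hypothesis of [Nsign_max]. *)
Lemma Nsign_left a x t : (2 <= n)%N -> cyclic_negative_feedback a ->
  solves a x -> x t != 0 ->
  \forall s \near t^'-, Lambda (x s) /\
    \forall z \near x t, Lambda z -> (Nsign z <= Nsign (x s))%N.
Proof.
move=> n2 ha dx xt0.
have : \forall s \near (- t)^'+, [/\ Lambda (x (- s)),
    forall i, x (- - t) i 0 != 0 -> 0 < x (- - t) i 0 * x (- s) i 0 &
    forall i, x (- - t) i 0 = 0 ->
      0 < - delta R i * x (- s) i 0 * x (- s) (ord_pred i) 0].
  apply: (cyclic_ode_signs (fun s => x (- s)) (fun i s => - a (- s) i i)
    (fun i s => - a (- s) i (ord_pred i))) => [s i|i|s i|].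
  - have := is_derive1_comp (dx (- s) i) (is_deriveNid s 1).
    by move/is_derive_eq; apply; rewrite cyclic_mulE//; ring.
  - case: ha => ac _ _ _; apply: continuousN.
    apply: (@continuous_comp _ _ _ -%R (fun s => a s i i)); last exact: ac.
    exact: oppr_continuous.
  - by rewrite mulrNN; exact: delta_coupling_gt0.
  - by rewrite opprK.
rewrite opprK => /nbhs_right0P H; apply/nbhs_left0P; apply: filterS H => s.
rewrite opprD opprK => -[Ls xs x0s]; split=> //.
apply: filterS (near_same_sign (x t)) => z xz Lz.
apply: (Nsign_max _ _ _ Ls Lz xs xz) => i /x0s.
by rewrite !mulNr oppr_gt0.
Qed.

(** [Nsign_min] with [x := y]: no coordinate vanishes, so its last hypothesis is vacuous. *)
Lemma Nsign_loc_le (y : 'cV[R]_n) : Lambda y ->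
  \forall z \near y, Lambda z -> (Nsign (z : 'cV[R]_n) <= Nsign y)%N.
Proof.
move=> Ly; apply: filterS (near_same_sign y) => z yz Lz.
apply: (@Nsign_min _ _ y) => // i yi; last by have := Ly i; rewrite yi eqxx.
by rewrite -expr2 exprn_even_gt0.
Qed.

Lemma Nsign_flow_lt a x m t : (2 <= n)%N -> cyclic_negative_feedback a ->
  solves a x -> x 0 != 0 ->
  (forall U, nbhs (x 0) U ->
    exists2 y, (U `&` @Lambda R n) y & (Nsign y < m)%N) ->
  0 < t -> \forall z \near x t, Lambda z -> (Nsign z < m)%N.
Proof.
move=> n2 ha dx x00 Q0 t0.
pose P s := \forall z \near x s, Lambda z -> (Nsign z < m)%N.
pose Q s := forall U, nbhs (x s) U ->
  exists2 y, (U `&` @Lambda R n) y & (Nsign y < m)%N.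
have PQ s : P s -> Q s.
  move=> Ps U xU; have [y [[Uy Py] Ly]] := Lambda_dense (filterI xU Ps).
  by exists y => //; exact: Py.
have xn0 s : 0 <= s -> x s != 0.
  by move=> s0; apply: linear_ode_neq0 dx _ _ _ => //; case: ha.
have Qright r : 0 <= r -> Q r -> \forall s \near r^'+, P s.
  move=> r0 Qr; apply: filterS (Nsign_right _ _ _ n2 ha dx (xn0 r r0)).
  move=> s [Ls /Qr[y [xy Ly] ym]]; apply: filterS (Nsign_loc_le _ Ls) => z zs Lz.
  by rewrite (leq_ltn_trans (zs Lz))// (leq_ltn_trans _ ym)//; exact: xy.
have Pleft r : 0 < r -> (forall s, 0 < s < r -> P s) -> P r.
  move=> r0 Ps; have H := Nsign_left _ _ _ n2 ha dx (xn0 r (ltW r0)).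
  have {H} H : \forall s \near r^'-, P r.
    apply: filterS3 (nbhs_left_gt r0) (nbhs_left_lt r) H => s s0 sr [Ls xr].
    have /Ps/nbhs_singleton Pxs : 0 < s < r by rewrite s0.
    by apply: filterS xr => z zs Lz; rewrite (leq_ltn_trans (zs Lz))//; exact: Pxs.
  by have [] := filter_ex H.
(* At the infimum of the bad times [Q] holds, by assumption if it is 0 and through [Pleft]
   otherwise; then [Qright] excludes bad times just after it. *)
apply: contrapT => Pt; pose E := [set s | 0 < s /\ ~ P s].
have Et : E t by [].
have hE : has_inf E by split; [exists t|exists 0 => s [/ltW]].
have inf0 : 0 <= inf E by apply: lb_le_inf; [exists t|move=> s [/ltW]].
have below s : 0 < s < inf E -> P s.
  move=> /andP[s0]; apply: contraPP => Ps; apply/negP; rewrite -leNgt.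
  by apply: (ge_inf hE.2).
have Pinf : 0 < inf E -> P (inf E) by move=> i0; exact: Pleft.
have Qinf : Q (inf E).
  by move: inf0; rewrite le_eqVlt => /predU1P[<-//|/Pinf /PQ].
have /at_rightP[e e0 H] := Qright _ inf0 Qinf.
have [s [s0 Ps] se] := inf_adherent e0 hE.
have : inf E <= s by exact: (ge_inf hE.2).
rewrite le_eqVlt => /predU1P[infs|infs].
  by apply: Ps; rewrite -infs; apply: Pinf; rewrite infs.
by apply: Ps; apply: H; rewrite infs.
Qed.

Lemma fundamental_solves a Phi (v : 'cV[R]_n) : fundamental_matrix a Phi ->
  solves a (fun t => Phi t *m v).
Proof.
move=> [_ dPhi] t i.
have dij j : is_derive t 1 (fun s => Phi s i j) ((a t *m Phi t) i j).
  have [dP DP] := dPhi t; split; first exact: (derivable_mxP _ _ _).1.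
  by rewrite -DP derive_mx// mxE.
have -> : (fun s => (Phi s *m v) i 0) = \sum_j (v j 0 \*: (fun s => Phi s i j)).
  apply/funext => s; rewrite mxE fct_sumE; apply: eq_bigr => j _.
  by rewrite [RHS]mulrC.
apply: is_derive_eq.
by rewrite mulmxA mxE; apply: eq_bigr => j _; rewrite [LHS]mulrC.
Qed.

End Cyclic.

Theorem proposition2p4 (R : realType) (n : nat) (hn : (2 <= n)%N)
    (a Phi : R -> 'M[R]_n)
    (ha : cyclic_negative_feedback a) (hPhi : fundamental_matrix a Phi)
    (h : nat) (hh : (h <= (ntilde n + 1) %/ 2)%N) (t : R) (ht : 0 < t) :
  (fun x : 'cV[R]_n => Phi t *m x) @` (closure (@K R n h) `\ 0)
    `<=` interior (closure (@K R n h)).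
Proof.
move=> _ [v [Kv v0] <-]; pose x s := Phi s *m v.
have x0 : x 0 = v by rewrite /x hPhi.1 mul1mx.
(* The strict form also covers [h = 0], where both sides are false. *)
have KP y : (Posz (NM y) <= 2 * Posz h - 1) = (NM y < 2 * h)%N by lia.
(* Near [v] there is a nonzero point [y] of [K_h]; its bound holds on a neighborhood of [y], which
   meets [Lambda]. *)
have Q0 U : nbhs (x 0) U ->
    exists2 y, (U `&` @Lambda R n) y & (Nsign y < 2 * h)%N.
  rewrite x0 => vU.
  have vn0 : \forall y \near v, y != 0.
    have [i vi] : exists i, v i 0 != 0 by apply/cV0Pn/eqP.
    apply: filterS (near_same_sign v) => y /(_ i vi).
    by apply: contraTneq => ->; rewrite mxE mulr0 ltxx.
  have [y [Ky [yU yn0]]] := Kv _ (filterI (nbhs_interior vU) vn0).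
  case: Ky => [y0|]; first by rewrite y0 eqxx in yn0.
  rewrite /= KP => Ny; have h0 : (0 < 2 * h)%N by case: (2 * h)%N Ny.
  have yN := (NM_ltP _ _ h0).1 Ny.
  have [z [[Uz Nz] Lz]] := Lambda_dense (filterI yU yN).
  by exists z => //; exact: Nz.
have xn0 : x 0 != 0 by rewrite x0; apply/eqP.
have Pt := Nsign_flow_lt _ _ _ _ hn ha (fundamental_solves _ _ v hPhi) xn0 Q0 ht.
have h0 : (0 < 2 * h)%N.
  by have [y _] := Q0 _ filterT; case: (2 * h)%N.
apply: filterS (nbhs_interior Pt) => y Py; apply: subset_closure; right.
by rewrite /= KP; apply/NM_ltP.
Qed.
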